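(* There exists (provably in $\mathsf{ZFC}$) a zero-dimensional regular topological space $X$ of cardinality $2^{\aleph_0}$ and of character $\mathfrak b$ such that $X\rightarrow(\mathrm{top}\,(\omega+1))^1_\omega$ holds, but $X\rightarrow(\mathrm{top}\,(\omega^2+1))^1_1$ fails.
   Context: For topological spaces $X,Y$ and a cardinal $\theta$, $X\rightarrow(\mathrm{top}\,Y)^1_\theta$ asserts that for every coloring $c:X\rightarrow\theta$ there is a map $\phi:Y\rightarrow X$ that is a homeomorphism from $Y$ onto its image $\mathrm{Im}(\phi)$ (with the subspace topology from $X$) such that $c$ is constant on $\mathrm{Im}(\phi)$. In particular, $X\rightarrow(\mathrm{top}\,Y)^1_1$ just says that $X$ contains a homeomorphic copy of $Y$. Ordinals $\alpha$ (such as $\omega+1$ and $\omega^2+1$, in ordinal arithmetic) carry the usual order topology. $\mathfrak b$ is the least size of an unbounded subfamily of ${}^\omega\omega$, where $\mathcal F\subseteq{}^\omega\omega$ is bounded if there is $g:\omega\rightarrow\omega$ such that for every $f\in\mathcal F$, $f(n)\le g(n)$ for all but finitely many $n$. The character of a space $X$ is $\chi(X)=\sup_{x\in X}\min\{|\mathcal N| : \mathcal N\text{ is a local base at }x\}$ (or $\aleph_0$ if this is finite). Regular spaces are assumed to be $T_1$. Zero-dimensional means having a base of clopen sets. *)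

(* Defs.v *)
From HB Require Import structures.
From mathcomp Require Import all_boot all_order.
From mathcomp Require Import boolp classical_sets functions cardinality filter.
From mathcomp Require Import topology_structure order_topology nat_topology.
From mathcomp Require Import initial_topology subtype_topology separation_axioms.

Set Implicit Arguments.
Unset Strict Implicit.
Unset Printing Implicit Defensive.

Import Order.TTheory.

Local Open Scope classical_set_scope.
Local Open Scope card_scope.

(* The ordinal sum [T + 1]: [Some x] is the element [x] of [T], and [None] is
   the additional greatest element. *)
Definition ord_succ (T : Type) : Type := option T.

Section OrdSuccOrder.
Context (d : Order.disp_t) (T : orderType d).

HB.instance Definition _ := Choice.copy (ord_succ T) (option T).

Definition ord_succ_le (x y : ord_succ T) : bool :=
  match x, y with
  | _, None => true
  | None, Some _ => false
  | Some a, Some b => (a <= b)%O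
  end.

Fact ord_succ_le_refl : reflexive ord_succ_le.
Proof. by case=> /=. Qed.

Fact ord_succ_le_anti : antisymmetric ord_succ_le.
Proof. by move=> [a|] [b|] //= /le_anti ->. Qed.

Fact ord_succ_le_trans : transitive ord_succ_le.
Proof. by move=> [a|] [b|] [c|] //=; apply: le_trans. Qed.

Fact ord_succ_le_total : total ord_succ_le.
Proof. by move=> [a|] [b|] //=; apply: le_total. Qed.

HB.instance Definition _ :=
  Order.Le_isPOrder.Build d (ord_succ T) ord_succ_le_refl ord_succ_le_anti ord_succ_le_trans.
HB.instance Definition _ :=
  Order.POrder_isTotal.Build d (ord_succ T) ord_succ_le_total.

End OrdSuccOrder.

Definition omega1 : topologicalType := order_topology (ord_succ nat).

(* The ordinal [omega * omega] is [omega] consecutive copies of [omega], that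
   is, [nat * nat] ordered with the first coordinate dominant. *)
Definition omega_sq1 : topologicalType := order_topology (ord_succ (nat *l nat)).

Definition homeomorphism (Y Z : topologicalType) (f : Y -> Z) : Prop :=
  continuous f /\
  exists g : Z -> Y, [/\ cancel f g, cancel g f & continuous g].

(* The type [range f] carries the subspace topology. *)
Definition to_range (Y X : Type) (f : Y -> X) : Y -> range f :=
  fun y => exist _ (f y) (mem_set (imageT f y)).

Definition arrow_top (X Y : topologicalType) (theta : Type) : Prop :=
  forall c : X -> theta, exists phi : Y -> X,
    homeomorphism (to_range phi) /\
    forall x x', range phi x -> range phi x' -> c x = c x'.

(* The library's [zero_dimensional] only asks that points be separated by
   clopen sets. *)
Definition has_clopen_base (X : topologicalType) : Prop :=
  exists2 B : set (set X), B `<=` clopen & basis B.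

(* A cardinal of the form [min {|A| : P A}] is represented by any set [A] that
   attains it. *)
Definition least_size (T : Type) (P : set (set T)) (A : set T) : Prop :=
  P A /\ forall B, P B -> A #<= B.

Definition bounded_family (F : set (nat -> nat)) : Prop :=
  exists g : nat -> nat, forall f, F f -> \forall n \near \oo, (f n <= g n)%N.

Definition local_base (X : topologicalType) (x : X) (N : set (set X)) : Prop :=
  N `<=` open_nbhs x /\ filter_from N id --> x.

(* [S] represents the supremum of the cardinals [|A|] for [A] in [C]. *)
Definition card_sup (T : Type) (C : set (set T)) (S : set T) : Prop :=
  (forall A, C A -> A #<= S) /\
  forall L : set T, (forall A, C A -> A #<= L) -> S #<= L.

(* The character of [X] is [|K|]. *)
Definition has_character (X : topologicalType) (U : Type) (K : set U) : Prop :=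
  exists S : set (set X),
    [/\ card_sup [set N | exists x : X, least_size (local_base x) N] S,
        finite_set S -> K #= [set: nat]
      & infinite_set S -> K #= S].

(* Main.v *)
Require Import Defs.
From HB Require Import structures.
From mathcomp Require Import all_boot all_order.
From mathcomp Require Import boolp classical_sets functions cardinality filter.
From mathcomp Require Import topology_structure order_topology nat_topology.
From mathcomp Require Import initial_topology subtype_topology separation_axioms.
From mathcomp Require Import interval set_interval.

(* The space refines the Cantor topology on [nat -> bool]. Each point [x] gets
   guessed points [s x l n], and a neighborhood of [x] consists of [x] and of
   the points that leave [x] at a late place [d] and agree up to [d + f d] with
   some [s x l n], [l, n <= d], where [f] ranges over an unbounded directed
   family of size b of nondecreasing functions. These sets are clopen.
   - Since [x] codes a countable family of points, for every coloring some [x]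
     guesses a countable subset of each color class that is dense in it; then
     points [s x l (c x)] of the color of [x] converge to [x].
   - A sequence that converges to [x] is almost contained in the guessed points,
     as otherwise it would bound the family of functions. In a copy of
     omega^2 + 1 with top [x], infinitely many points of each copy of omega are
     not guessed, and a choice of one in each copy converges to [x].
   - The same boundedness argument shows that a local base at a point that is a
     limit of guessed points has at least b elements. *)

Set Implicit Arguments.
Unset Strict Implicit.
Unset Printing Implicit Defensive.

Import Order.TTheory.

Local Open Scope classical_set_scope.
Local Open Scope card_scope.

(** * Cardinals and unbounded families *)

Lemma inj_on_card_le (T U : Type) (A : set T) (B : set U) (f : T -> U) :
  set_fun A B f -> set_inj A f -> A #<= B.
Proof.
move=> fAB fI; have : $|{injfun A >-> B}| by apply/injfunPex; exists f.
by case=> g; exact: inj_card_le g.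
Qed.

Lemma card_le_inj_on (T : Type) (U : pointedType) (A : set T) (B : set U) :
  A #<= B -> exists2 f : T -> U, set_fun A B f & set_inj A f.
Proof. by move=> /pcard_leP /injfunPex. Qed.

(* Maximal sets of choice functions that pairwise differ at every member of
   [P]: by maximality, their values exhaust some member of [P], which therefore
   injects into all the others. *)
Lemma exists_least_size (T : pointedType) (P : set (set T)) :
  P !=set0 -> exists A, least_size P A.
Proof.
move=> [B0 PB0].
pose Q (S : set (set T -> T)) := forall h, S h -> forall B, P B ->
  B (h B) /\ forall h', S h' -> h B = h' B -> h = h'.
have [|S [QS maxS]] := @Zorn_bigcup _ Q.
  move=> F FQ totF h [S FS Sh] B PB.
  split; first by case: (FQ _ FS h Sh B PB).
  move=> h' [S' FS' Sh'] E; case: (totF _ _ FS FS') => ss.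
    by case: (FQ _ FS' h (ss _ Sh) B PB) => _; apply.
  by case: (FQ _ FS h Sh B PB) => _; apply => //; apply: ss.
have [A PA surjA] : exists2 A, P A &
    forall a, exists h, A a -> S h /\ h A = a.
  apply: contrapT => nA.
  have : forall B, exists b, P B -> B b /\ forall h, S h -> h B <> b.
    move=> B; have [PB|nPB] := pselect (P B); last by exists point.
    apply: contrapT => nb; apply: nA; exists B => // a.
    have [Ba|nBa] := pselect (B a); last by exists (fun=> point).
    apply: contrapT => na; apply: nb.
    exists a => _; split=> // h Sh E; apply: na.
    by exists h.
  move=> /choice[h0 h0P].
  apply: (maxS (S `|` [set h0])).
    split; first by move=> h; left.
    move=> /(_ h0 (or_intror erefl)) Sh0.
    by have [_ /(_ _ Sh0)] := h0P _ PB0.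
  move=> h [Sh|->] B PB.
    split; first by case: (QS h Sh B PB).
    move=> h' [Sh'|->]; first by case: (QS h Sh B PB) => _; apply.
    by case: (h0P _ PB) => _ /(_ _ Sh).
  case: (h0P _ PB) => Bh0 nS; split=> // h' [Sh' E|->] //.
  by case: (nS _ Sh').
exists A; split=> // B PB.
have [k kP] := choice surjA.
apply: (@inj_on_card_le _ _ _ _ (fun a => k a B)).
  by move=> a Aa /=; case: (kP a Aa) => Sk _; case: (QS _ Sk B PB).
move=> a b /set_mem Aa /set_mem Ab /=.
case: (kP a Aa) => Sa Ea; case: (kP b Ab) => Sb Eb E.
rewrite -Ea -Eb; congr (_ A).
by case: (QS _ Sa B PB) => _; apply.
Qed.

Lemma card_le_total (T : pointedType) (A B : set T) : A #<= B \/ B #<= A.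
Proof.
have [|C [[->|->] leC]] := @exists_least_size T [set A; B]; first by exists A; left.
  by left; apply: leC; right.
by right; apply: leC; left.
Qed.

(** * Injections of the square of an infinite set into the set *)

Section Pairing.
Variable T : pointedType.
Implicit Types (A D : set T) (G : set (T * T * T)).

Definition field G : set T :=
  [set a | exists b c, G (a, b, c) \/ G (b, a, c) \/ G (b, c, a)].

(** Partial pairings are kept as graphs, with their domain read off as [field], so that Zorn's lemma
    applies to them under inclusion. *)
Definition pairing_graph G : Prop :=
  [/\ forall a b c c', G (a, b, c) -> G (a, b, c') -> c = c',
      forall a b a' b' c, G (a, b, c) -> G (a', b', c) -> a = a' /\ b = b'
    & forall a b, field G a -> field G b -> exists c, G (a, b, c)].

Definition pairing_on D (f : T -> T -> T) : Prop :=
  (forall a b, D a -> D b -> D (f a b)) /\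
  forall a b a' b', D a -> D b -> D a' -> D b' -> f a b = f a' b' ->
    a = a' /\ b = b'.

Lemma field_subset G G' : G `<=` G' -> field G `<=` field G'.
Proof. by move=> GG' a [b [c [h|[h|h]]]]; exists b, c; move/GG': h; tauto. Qed.

Lemma field_bigcup (C : set (set (T * T * T))) a :
  field (\bigcup_(G in C) G) a -> exists2 G, C G & field G a.
Proof.
by move=> [b [c [[G CG h]|[[G CG h]|[G CG h]]]]]; exists G => //; exists b, c; tauto.
Qed.

Lemma pairing_graph_bigcup (C : set (set (T * T * T))) :
  C `<=` pairing_graph -> total_on C subset ->
  pairing_graph (\bigcup_(G in C) G).
Proof.
move=> CP totC; split.
- move=> a b c c' [G CG Gc] [G' CG' Gc'].
  have [ss|ss] := totC _ _ CG CG'.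
    by have [h _ _] := CP _ CG'; apply: h Gc'; apply: ss.
  by have [h _ _] := CP _ CG; apply: h Gc _; apply: ss.
- move=> a b a' b' c [G CG Gc] [G' CG' Gc'].
  have [ss|ss] := totC _ _ CG CG'.
    by have [_ h _] := CP _ CG'; apply: h Gc'; apply: ss.
  by have [_ h _] := CP _ CG; apply: h Gc _; apply: ss.
- move=> a b /field_bigcup[G CG Ga] /field_bigcup[G' CG' Gb].
  have [ss|ss] := totC _ _ CG CG'.
    have [_ _ h] := CP _ CG'.
    by have [c Gc] := h a b (field_subset ss Ga) Gb; exists c, G'.
  have [_ _ h] := CP _ CG.
  by have [c Gc] := h a b Ga (field_subset ss Gb); exists c, G.
Qed.

Lemma pairing_graph_fun G : pairing_graph G ->
  exists2 f, pairing_on (field G) f &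
    forall a b c, G (a, b, c) <-> [/\ field G a, field G b & c = f a b].
Proof.
move=> [Gf Gi Gt].
have : forall ab : T * T, exists c, field G ab.1 -> field G ab.2 -> G (ab.1, ab.2, c).
  move=> [a b] /=; have [Ga|nGa] := pselect (field G a); last by exists point.
  have [Gb|nGb] := pselect (field G b); last by exists point.
  by have [c Gc] := Gt a b Ga Gb; exists c.
move=> /choice[f0 f0P]; pose f a b := f0 (a, b).
have fP a b : field G a -> field G b -> G (a, b, f a b) by exact: (f0P (a, b)).
exists f.
  split=> [a b Ga Gb|a b a' b' Ga Gb Ga' Gb' E].
    by exists a, b; right; right; exact: fP.
  apply: Gi (fP _ _ Ga Gb) _.
  by rewrite E; exact: fP.
move=> a b c; split=> [Gc|[Ga Gb ->]]; last exact: fP.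
have Ga : field G a by exists b, c; left.
have Gb : field G b by exists a, c; right; left.
by split=> //; apply: Gf Gc (fP _ _ _ _).
Qed.

Definition fun_graph D (f : T -> T -> T) : set (T * T * T) :=
  [set p | [/\ D p.1.1, D p.1.2 & p.2 = f p.1.1 p.1.2]].

Lemma fun_graphP D f : pairing_on D f ->
  pairing_graph (fun_graph D f) /\ field (fun_graph D f) = D.
Proof.
move=> [fD fI]; have E : field (fun_graph D f) = D.
  apply/seteqP; split=> [a [b [c]]|a Da]; last by exists a, (f a a); left.
  by move=> [[/= Da _ _]|[[/= _ Da _]|[/= Db Dc ->]]] //; apply: fD.
split=> //; split=> [a b c c' [_ _ /= ->] [_ _ /= ->]//|a b a' b' c|].
  by move=> [/= Da Db ->] [/= Da' Db']; exact: fI.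
by rewrite E => a b Da Db; exists (f a b).
Qed.

(* A pair with a coordinate in the copy [g @` D] is sent into the copy; the
   factor [e (s + t.*2)] records which coordinates lie there. *)
Lemma pairing_extend D C f (e : nat -> T) (g : T -> T) :
  pairing_on D f -> injective e -> (forall i, D (e i)) ->
  set_fun D C g -> set_inj D g -> (forall a, C a -> ~ D a) ->
  exists f', [/\ pairing_on (D `|` g @` D) f' &
    forall a b, D a -> D b -> f' a b = f a b].
Proof.
move=> [fD fI] eI eD gC gI CD.
have : forall x, exists sa : bool * T, (D `|` g @` D) x ->
    D sa.2 /\ x = if sa.1 then g sa.2 else sa.2.
  move=> x; have [Dx|nDx] := pselect (D x); first by exists (false, x).
  have [[a Da <-]|ngx] := pselect ((g @` D) x); first by exists (true, a).
  by exists (false, x); case.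
move=> /choice[u uP].
pose lift (s : bool) a := if s then g a else a.
have liftD s a : D a -> (D `|` g @` D) (lift s a).
  by case: s => Da; [right; exists a | left].
have liftI s t a b : D a -> D b -> lift s a = lift t b -> s = t /\ a = b.
  move=> Da Db; case: s; case: t => /= E.
  - by split=> //; apply: gI E; exact: mem_set.
  - by case: (CD _ (gC _ Da)); rewrite E.
  - by case: (CD _ (gC _ Db)); rewrite -E.
  - by [].
have uD s a : D a -> u (lift s a) = (s, a).
  move=> Da; case: (uP _ (liftD s a Da)) => Du E.
  by case: (u _) Du E => t b /= Db /(liftI _ _ _ _ Da Db)[-> ->].
pose f' x y := let: (s, a) := u x in let: (t, b) := u y in
  if s || t then g (f (e (s + t.*2)%N) (f a b)) else f a b.
have f'E s t a b : D a -> D b -> f' (lift s a) (lift t b) =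
    lift (s || t) (if s || t then f (e (s + t.*2)%N) (f a b) else f a b).
  by move=> Da Db; rewrite /f' !uD //; case: (s || t).
have liftP x : (D `|` g @` D) x -> exists s a, D a /\ x = lift s a.
  by move=> /uP[Du E]; exists (u x).1, (u x).2.
exists f'; split; last by move=> a b Da Db; rewrite (f'E false false).
have valD s t a b : D a -> D b ->
    D (if s || t then f (e (s + t.*2)%N) (f a b) else f a b).
  move=> Da Db; case: ifP => _; last exact: (fD).
  by apply: (fD) => //; exact: (fD).
split=> [x y /liftP[s [a [Da ->]]] /liftP[t [b [Db ->]]]|].
  by rewrite f'E //; apply: liftD; apply: valD.
move=> x y x' y' /liftP[s [a [Da ->]]] /liftP[t [b [Db ->]]].
move=> /liftP[s' [a' [Da' ->]]] /liftP[t' [b' [Db' ->]]].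
rewrite !f'E // => /liftI => /(_ (valD _ _ _ _ Da Db) (valD _ _ _ _ Da' Db'))[Est].
(* With no coordinate in the copy, all four flags are false; otherwise [s + t.*2] recovers both
   flags. *)
rewrite -Est; case st: (s || t); last first.
  move: Est; rewrite st; case: s t s' t' st => [] [] [] [] //= _ _ E.
  by have [-> ->] := fI _ _ _ _ Da Db Da' Db' E.
have Dv := fD _ _ Da Db; have Dv' := fD _ _ Da' Db'.
move=> /(fI _ _ _ _ (eD _) Dv (eD _) Dv')[/eI Est' E].
have [-> ->] := fI _ _ _ _ Da Db Da' Db' E.
by case: s t s' t' st Est Est' {E} => [] [] [] [].
Qed.

(** Let [D] be the field of a maximal pairing graph in [A]. If [D] injected into its complement in
    [A], the copy there would extend the pairing. So the complement injects into [D], hence so does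
    [A], and the pairing on [D] transfers to [A]. *)
Lemma pairing_infinite A : infinite_set A -> exists f, pairing_on A f.
Proof.
move=> /infiniteP/card_le_inj_on[e eA eI].
have {}eI : injective e by move=> i j; apply: eI; exact: mem_set.
have {}eA i : A (e i) by exact: eA.
have : forall x, exists i, range e x -> x = e i.
  move=> x; have [[i _ <-]|] := pselect (range e x); first by exists i.
  by exists 0.
move=> /choice[r rP]; have rK i : r (e i) = i by apply: eI; rewrite -rP.
pose f0 x y := e (pickle (r x, r y)).
have f0P : pairing_on (range e) f0.
  split=> [_ _ [i _ <-] [j _ <-]|]; first by exists (pickle (r (e i), r (e j))).
  move=> _ _ _ _ [i _ <-] [j _ <-] [i' _ <-] [j' _ <-].
  by rewrite /f0 !rK => /eI /(pcan_inj pickleK) [-> ->].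
have [G0P fG0] := fun_graphP f0P; set G0 := fun_graph _ _ in G0P fG0.
(* Joining [G0] keeps the maximal field infinite. *)
pose Q G := pairing_graph (G `|` G0) /\ field (G `|` G0) `<=` A.
have [C CQ totC|M [[]]] := @Zorn_bigcup _ Q.
  (* Adding [set0] covers the empty chain, for which the union must be [G0]. *)
  pose C' := [set G `|` G0 | G in C `|` [set set0]].
  rewrite /Q; have -> : \bigcup_(G in C) G `|` G0 = \bigcup_(G in C') G.
    apply/seteqP; split=> [p [[G CG Gp]|G0p]|p [_ [G [CG|->] <-]]].
    - by exists (G `|` G0); [exists G => //; left | left].
    - by exists (set0 `|` G0); [exists set0 => //; right | right].
    - by move=> [Gp|]; [left; exists G | right].
    - by move=> [|]; [|right].
  have C'P G : C' G -> pairing_graph G /\ field G `<=` A.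
    move=> [G' [CG'|->] <-]; first exact: CQ.
    by rewrite set0U fG0; split=> // _ [i _ <-].
  have totC' : total_on C' subset.
    move=> _ _ [G1 CG1 <-] [G2 CG2 <-].
    case: CG1 CG2 => [CG1|->] [CG2|->]; rewrite ?set0U.
    - by have [ss|ss] := totC _ _ CG1 CG2; [left|right]; apply: setSU.
    - by right=> p; right.
    - by left=> p; right.
    - by left.
  split; first by apply: pairing_graph_bigcup => // G /C'P[].
  by move=> a /field_bigcup[G /C'P[_ GA] /GA].
set G := M `|` G0; set D := field G => GP DA maxM.
have [f fP fG] := pairing_graph_fun GP.
have eD i : D (e i).
  by apply: (field_subset (@subsetUr _ M G0)); rewrite fG0; exists i.
have [leD|leD] := card_le_total D (A `\` D).
  have [g gC gI] := card_le_inj_on leD.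
  have [_ nD] : A (g (e 0)) /\ ~ D (g (e 0)) by exact: gC.
  have [//|f' [f'P f'f]] := pairing_extend fP eI eD gC gI.
    by move=> a [].
  have [G'P fG'] := fun_graphP f'P; set G' := fun_graph _ _ in G'P fG'.
  have GG' : G `<=` G'.
    by move=> [[a b] c] /fG[Da Db ->]; split; rewrite /= ?f'f //; left.
  case: (maxM G'); last first.
    rewrite /Q; have -> : G' `|` G0 = G' by apply/setUidPl => p G0p; apply: GG'; right.
    split=> //; rewrite fG' => a [/DA//|[b Db <-]].
    by case: (gC _ Db).
  split=> [p Mp|sG']; first by apply: GG'; left.
  have : field G' (g (e 0)) by rewrite fG'; right; exists (e 0); first exact: eD.
  by move=> /(field_subset sG')/(field_subset (@subsetUl _ M G0)).
have [g gD gI] := card_le_inj_on leD.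
case: fP => fD fI.
(* The tags [e 0] and [e 1] keep the images of [D] and of its complement apart, so [psi] injects [A]
   into [D]. *)
pose psi a := if pselect (D a) then f (e 0) a else f (e 1) (g a).
have psiD a : A a -> D (psi a).
  move=> Aa; rewrite /psi; case: pselect => Da; first exact: fD (eD _) Da.
  exact: fD (eD _) (gD _ (conj Aa Da)).
have psiI a b : A a -> A b -> psi a = psi b -> a = b.
  move=> Aa Ab; rewrite /psi; case: pselect => Da; case: pselect => Db.
  - by move=> /(fI _ _ _ _ (eD _) Da (eD _) Db)[].
  - by move=> /(fI _ _ _ _ (eD _) Da (eD _) (gD b (conj Ab Db)))[/eI].
  - by move=> /(fI _ _ _ _ (eD _) (gD a (conj Aa Da)) (eD _) Db)[/eI].
  - move=> /(fI _ _ _ _ (eD _) (gD a (conj Aa Da)) (eD _) (gD b (conj Ab Db)))[_].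
    by apply: gI; exact: mem_set.
exists (fun a b => f (psi a) (psi b)); split=> [a b Aa Ab|].
  by apply: DA; apply: fD; apply: psiD.
move=> a b a' b' Aa Ab Aa' Ab' E.
have [] := fI _ _ _ _ (psiD _ Aa) (psiD _ Ab) (psiD _ Aa') (psiD _ Ab') E.
by move=> /psiI-> // /psiI->.
Qed.

End Pairing.

(** Folding the pairing over a list is injective among lists of one length, so the length is coded
    too. *)
Lemma card_le_finite_seqs (T : pointedType) (A : set T) : infinite_set A ->
  [set Nl : nat * seq T | forall x, x \in Nl.2 -> A x] #<= A.
Proof.
move=> Ainf; have [p [pA pI]] := pairing_infinite Ainf.
move: Ainf => /infiniteP/card_le_inj_on[e eA eI].
have {}eI : injective e by move=> i j; apply: eI; exact: mem_set.
have {}eA i : A (e i) by exact: eA.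
pose enc := foldr p (e 0).
have encA l : (forall x, x \in l -> A x) -> A (enc l).
  elim: l => [_|x l IH lA] /=; first exact: eA.
  apply: pA; first exact/lA/mem_head.
  by apply: IH => y ly; apply: lA; rewrite in_cons ly orbT.
apply: (@inj_on_card_le _ _ _ _ (fun Nl => p (e Nl.1) (p (e (size Nl.2)) (enc Nl.2)))).
  by move=> [N l] /= lA; apply: (pA) => //; apply: (pA) => //; apply: encA.
move=> [N l] [N' l'] /set_mem /= lA /set_mem /= lA' E.
have [/eI-> {E}E] := pI _ _ _ _
  (eA _) (pA _ _ (eA _) (encA _ lA)) (eA _) (pA _ _ (eA _) (encA _ lA')) E.
have [/eI sz] := pI _ _ _ _ (eA _) (encA _ lA) (eA _) (encA _ lA') E.
move=> {}E; congr (_, _).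
elim: l l' lA lA' sz E => [|x l IH] [|x' l'] //= lA lA' [sz] E.
have lA1 y : y \in l -> A y by move=> yl; apply: lA; rewrite in_cons yl orbT.
have lA'1 y : y \in l' -> A y by move=> yl; apply: lA'; rewrite in_cons yl orbT.
have [-> E'] := pI _ _ _ _
  (lA _ (mem_head _ _)) (encA _ lA1) (lA' _ (mem_head _ _)) (encA _ lA'1) E.
by congr (_ :: _); apply: IH.
Qed.

(** * Bounded families of functions *)

Lemma finite_bounded_family (G : set (nat -> nat)) :
  finite_set G -> bounded_family G.
Proof.
move=> /finite_seqP[l ->]; exists (fun n => \sum_(f <- l) f n) => f /= fl.
by apply: nearW => n; rewrite (big_rem f fl) /= leq_addr.
Qed.

Lemma unbounded_family_sub_dominated (G H : set (nat -> nat)) :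
  (forall f, G f -> exists2 h, H h & forall n, f n <= h n) ->
  bounded_family H -> bounded_family G.
Proof.
move=> GH [g Hg]; exists g => f /GH[h Hh fh].
by apply: filterS (Hg h Hh) => n; apply: leq_trans.
Qed.

(** The first clause carries bounds from a place down to earlier ones, the second lets neighborhoods
    shrink into any cylinder, and the third lets them be intersected. *)
Definition directed_family (F : set (nat -> nat)) : Prop :=
  [/\ forall f, F f -> {homo f : m n / m <= n},
      forall N, exists2 f, F f & N <= f 0
    & forall f g, F f -> F g ->
        exists h, [/\ F h, forall n, f n <= h n & forall n, g n <= h n]].

(** From an unbounded family of least size, take all finite sums of partial-sum functions plus a
    constant. The original family is infinite, so its size bounds the number of these sums. *)
Lemma exists_directed_least_unbounded : exists F,
  directed_family F /\ least_size [set G | ~ bounded_family G] F.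
Proof.
have [|F0 [F0u F0min]] := @exists_least_size _ [set G | ~ bounded_family G].
  exists setT => -[g /(_ (fun n => (g n).+1) I)[N _ /(_ N (leqnn N))]].
  by rewrite ltnn.
have F0inf : infinite_set F0 by move=> /finite_bounded_family.
pose mono (f : nat -> nat) n := \sum_(i < n.+1) f i.
pose comb (Nl : nat * seq (nat -> nat)) n := Nl.1 + \sum_(f <- Nl.2) mono f n.
pose L := [set Nl : nat * seq (nat -> nat) | forall f, f \in Nl.2 -> F0 f].
have mono_homo f : {homo mono f : m n / m <= n}.
  move=> m n mn; rewrite /mono (big_ord_widen n.+1 (fun i => f i)) //.
  by rewrite big_mkcond /=; apply: leq_sum => i _; case: ifP.
have comb_homo Nl : {homo comb Nl : m n / m <= n}.
  move=> m n mn; rewrite /comb leq_add2l.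
  by apply: leq_sum => f _; exact: mono_homo.
have dom f : F0 f -> exists2 h, (comb @` L) h & forall n, f n <= h n.
  move=> F0f; exists (comb (0, [:: f])).
    by exists (0, [:: f]) => // g /=; rewrite inE => /eqP->.
  by move=> n; rewrite /comb /= big_seq1 add0n /mono big_ord_recr /= leq_addl.
have unb : ~ bounded_family (comb @` L).
  by move/(unbounded_family_sub_dominated dom).
exists (comb @` L); split; last first.
  split=> // B /F0min; apply: card_le_trans.
  by apply: card_le_trans (card_image_le _ _) (card_le_finite_seqs F0inf).
split=> [_ [Nl _ <-]|N|_ _ [[N l] lF <-] [[N' l'] lF' <-]]; first exact: comb_homo.
  by exists (comb (N, [::])); [exists (N, [::]) | rewrite /comb /= big_nil addn0].
exists (comb (N + N', l ++ l')); split.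
- by exists (N + N', l ++ l') => // f /=; rewrite mem_cat => /orP[/lF|/lF'].
- by move=> n; rewrite /comb /= big_cat /= addnACA leq_addr.
- by move=> n; rewrite /comb /= big_cat /= addnACA leq_addl.
Qed.

(** * Binary sequences and guessing *)

Definition binseq : Type := nat -> bool.

Definition agree (k : nat) (x y : binseq) : Prop := forall i, i < k -> x i = y i.

Definition splits_at (d : nat) (x y : binseq) : Prop := agree d x y /\ x d <> y d.

Lemma agree_sym k x y : agree k x y -> agree k y x.
Proof. by move=> xy i ik; rewrite xy. Qed.

Lemma agree_trans k x y z : agree k x y -> agree k y z -> agree k x z.
Proof. by move=> xy yz i ik; rewrite xy // yz. Qed.

Lemma agree_le k k' x y : k <= k' -> agree k' x y -> agree k x y.
Proof. by move=> kk' xy i ik; apply: xy; apply: leq_trans kk'. Qed.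

Lemma neq_splits x y : x <> y -> exists d, splits_at d x y.
Proof.
move=> xy; have ex : exists i, x i != y i.
  apply: contrapT => nex; apply: xy; apply/funext => i.
  by apply: contrapT => xyi; apply: nex; exists i; apply/eqP.
exists (ex_minn ex); case: ex_minnP => d /eqP xyd dmin; split=> // i id.
by apply: contrapT => /eqP /dmin; rewrite leqNgt id.
Qed.

Lemma splits_neq d x y : splits_at d x y -> x <> y.
Proof. by move=> [_ xyd] E; apply: xyd; rewrite E. Qed.

Lemma agree_splits_le k d x y : agree k x y -> splits_at d x y -> k <= d.
Proof. by move=> xy [_ xyd]; rewrite leqNgt; apply/negP => /xy. Qed.

Lemma splits_uniq d d' x y : splits_at d x y -> splits_at d' x y -> d = d'.
Proof.
move=> dxy d'xy; apply/eqP; rewrite eqn_leq.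
by rewrite (agree_splits_le dxy.1 d'xy) (agree_splits_le d'xy.1 dxy).
Qed.

Lemma splits_agree k d x y z :
  splits_at d x y -> agree k y z -> d < k -> splits_at d x z.
Proof.
move=> [xy xyd] yz dk; split; last by rewrite -yz.
by apply: agree_trans xy (agree_le (ltnW dk) yz).
Qed.

(** Only finitely many points [t l n] are concerned, and each one other than [y] differs from [y] at
    some finite place. *)
Lemma agree_separates (y : binseq) (t : nat -> nat -> binseq) (d : nat) :
  exists L, forall l n, l <= d -> n <= d -> agree L y (t l n) -> y = t l n.
Proof.
have : forall ln : nat * nat, exists k, agree k.+1 y (t ln.1 ln.2) -> y = t ln.1 ln.2.
  move=> [l n] /=; have [E|/neq_splits[k [_ yk]]] := pselect (y = t l n); first by exists 0.
  by exists k => /(_ k (leqnn _)).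
move=> /choice[k kP]; exists (\max_(l < d.+1) \max_(n < d.+1) k (val l, val n)).+1.
move=> l n ld nd yt; apply: (kP (l, n)) => /=; apply: agree_le yt; rewrite ltnS.
have ld' : l < d.+1 by [].
have nd' : n < d.+1 by [].
apply: leq_trans (leq_bigmax (Ordinal ld')).
exact: (leq_bigmax (F := fun n : 'I_d.+1 => k (l, val n)) (Ordinal nd')).
Qed.

(** Cantor's diagonal argument confined to the places [h i], where [y] differs from [p i]. *)
Lemma avoid_sequence (p : nat -> binseq) (y0 : binseq) (h : nat -> nat) :
  injective h -> exists y : binseq,
    (forall j, (forall i, h i <> j) -> y j = y0 j) /\ forall i, y <> p i.
Proof.
move=> hI.
have : forall j, exists b, (forall i, h i = j -> b = ~~ p i j) /\
    ((forall i, h i <> j) -> b = y0 j).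
  move=> j; have [[i hi]|nex] := pselect (exists i, h i = j).
    exists (~~ p i j); split; last by move=> /(_ i).
    by move=> i'; rewrite -hi => /hI->.
  exists (y0 j); split=> // i hi; case: nex; by exists i.
move=> /choice[y yP]; exists y; split=> [j|i]; first by case: (yP j).
by move=> E; case: (yP (h i)) => /(_ i erefl); rewrite E; case: (p i _).
Qed.

(* The even coordinates of [x] code a guess [D] for a family of points of each
   color [n] in each cylinder [sigma]; the odd coordinates leave room to keep
   [x] off the countable range of [D]. *)
Lemma exists_guessing : exists s : binseq -> nat -> nat -> binseq,
  forall c : binseq -> nat, exists x, forall l,
    [/\ s x l (c x) <> x, agree l x (s x l (c x)) & c (s x l (c x)) = c x].
Proof.
(* The decoding is fixed before the coloring is given; only [x] will depend on [c]. *)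
exists (fun x l n i => x (pickle (mkseq x l, n, i)).*2) => c.
have : forall sn : seq bool * nat, exists y : binseq,
    (exists z : binseq, mkseq z (size sn.1) = sn.1 /\ c z = sn.2) ->
    mkseq y (size sn.1) = sn.1 /\ c y = sn.2.
  move=> sn; have [[z zP]|nz] := pselect
    (exists z : binseq, mkseq z (size sn.1) = sn.1 /\ c z = sn.2).
    by exists z.
  by exists (fun=> true) => /nz.
move=> /choice[D DP].
pose x0 (j : nat) := if unpickle j./2 is Some (sn, i) then D sn i else true.
pose p (j : nat) := if unpickle j is Some sn then D sn else fun=> true.
have [|x [xE xp]] := @avoid_sequence p x0 (fun i => i.*2.+1).
  by move=> i j [/double_inj].
exists x => l; set n := c x.
have -> : (fun i => x (pickle (mkseq x l, n, i)).*2) = D (mkseq x l, n).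
  apply/funext => i; rewrite xE ?/x0 ?doubleK ?pickleK //.
  by move=> j /(congr1 odd); rewrite /= !odd_double.
(* The point [x] itself shows that its color occurs in its own cylinder, so the guess there is a
   genuine one. *)
have [|E1 E2] := DP (mkseq x l, n); first by exists x; rewrite size_mkseq.
split=> //.
- by move=> E; apply: (xp (pickle (mkseq x l, n))); rewrite /p pickleK.
- move=> i il; move: E1 => /= /(congr1 (fun u => nth true u i)).
  by rewrite size_mkseq !nth_mkseq.
Qed.

(** * Order topologies and embeddings *)

(** Keeps the left half of a neighborhood, since limits in the two ordinals are approached from
    below. *)
Lemma order_nbhs_left (d : Order.disp_t) (T : orderType d)
    (x : order_topology T) (A : set (order_topology T)) : nbhs x A ->
  (forall y : T, (y <= x)%O -> A y) \/
  exists2 a : T, (a < x)%O & forall y : T, (a < y)%O -> (y <= x)%O -> A y.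
Proof.
rewrite order_nbhs_itv => -[[lb rb] [oi xi] iA].
have yrb (y : T) : (y <= x)%O -> (BRight y <= rb)%O.
  move=> yx; move: xi; rewrite itv_boundlr => /andP[_]; apply: le_trans.
  by rewrite bnd_simp.
case: lb => [[] a|[]] in oi xi iA *.
- by have := itv_open_ends_lside oi.
- right; exists a; first by move: xi; rewrite itv_boundlr => /andP[].
  by move=> y ay yx; apply: iA; rewrite /= itv_boundlr yrb // andbT bnd_simp.
- by left=> y yx; apply: iA; rewrite /= itv_boundlr yrb // andbT.
- by have := itv_open_ends_linfty oi.
Qed.

Lemma order_nbhs_lt (d : Order.disp_t) (T : orderType d) (x a : T) :
  (x < a)%O -> nbhs (x : order_topology T) [set y : T | (y < a)%O].
Proof.
move=> xa; have -> : [set y : T | (y < a)%O] = [set` `]-oo, a[%O].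
  by apply/seteqP; split=> y; rewrite /= in_itv.
by apply: open_nbhs_nbhs; split;
  [exact: (@lray_open _ (order_topology T))|rewrite /= in_itv].
Qed.

Lemma order_nbhs_gt (d : Order.disp_t) (T : orderType d) (x a : T) :
  (a < x)%O -> nbhs (x : order_topology T) [set y : T | (a < y)%O].
Proof.
move=> ax; have -> : [set y : T | (a < y)%O] = [set` `]a, +oo[%O].
  by apply/seteqP; split=> y; rewrite /= in_itv andbT.
by apply: open_nbhs_nbhs; split;
  [exact: (@rray_open _ (order_topology T))|rewrite /= in_itv andbT].
Qed.

Section OrdSuccOrderTheory.
Context (d : Order.disp_t) (T : orderType d).
Implicit Types a b : T.

Lemma le_SomeSome a b : ((Some a : ord_succ T) <= Some b)%O = (a <= b)%O.
Proof. by []. Qed.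

Lemma lt_SomeSome a b : ((Some a : ord_succ T) < Some b)%O = (a < b)%O.
Proof. by rewrite !ltNge. Qed.

Lemma lt_SomeNone a : ((Some a : ord_succ T) < None)%O.
Proof. by rewrite ltNge. Qed.

Lemma lt_NoneSome a : ((None : ord_succ T) < Some a)%O = false.
Proof. by rewrite ltNge. Qed.

End OrdSuccOrderTheory.

Lemma nbhs_omega1_Some (k : nat) : nbhs (Some k : omega1) [set Some k].
Proof.
have : nbhs (Some k : omega1) [set y : ord_succ nat | (y < Some k.+1)%O].
  by apply: order_nbhs_lt; rewrite lt_SomeSome ltEnat /=.
case: k => [|k].
  apply: filterS => -[i|]; rewrite /= ?lt_NoneSome // lt_SomeSome ltEnat /=.
  by rewrite ltnS leqn0 => /eqP->.
have : nbhs (Some k.+1 : omega1)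
    [set y : ord_succ nat | ((Some k : ord_succ nat) < y)%O].
  by apply: order_nbhs_gt; rewrite lt_SomeSome ltEnat /=.
apply: filterS2 => -[i|]; rewrite /= ?lt_NoneSome // !lt_SomeSome !ltEnat /=.
by move=> i1 i2; congr Some; apply/eqP; rewrite eqn_leq -ltnS i1 i2.
Qed.

Lemma nbhs_omega1_None (N : nat) :
  nbhs (None : omega1) [set p | if p is Some k then N < k else True].
Proof.
have : nbhs (None : omega1)
    [set y : ord_succ nat | ((Some N : ord_succ nat) < y)%O].
  by apply: order_nbhs_gt; rewrite lt_SomeNone.
by apply: filterS => -[i|] //=; rewrite lt_SomeSome ltEnat.
Qed.

Lemma nbhs_omega1_NoneE (A : set omega1) : nbhs (None : omega1) A ->
  exists N, forall k, N <= k -> A (Some k).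
Proof.
move=> /order_nbhs_left[lA|[[N|] //= _ lA]]; first by exists 0 => k _; apply: lA.
by exists N.+1 => k Nk; apply: lA => //; rewrite lt_SomeSome ltEnat.
Qed.

Lemma nbhs_omega_sq1_None (A : set omega_sq1) : nbhs (None : omega_sq1) A ->
  exists N, forall m k, N <= m -> A (Some (m, k)).
Proof.
move=> /order_nbhs_left[lA|[[[N i]|] //= _ lA]].
  by exists 0 => m k _; apply: lA.
exists N.+1 => m k Nm; apply: lA => //; rewrite lt_SomeSome.
by rewrite Order.ProdLexiOrder.ltEprodlexi /= !leEnat ltnW //= leqNgt Nm.
Qed.

(** The first element of copy [m.+1] of omega is the limit of copy [m]. *)
Lemma nbhs_omega_sq1_limit m (A : set omega_sq1) :
  nbhs (Some (m.+1, 0) : omega_sq1) A -> exists k, A (Some (m, k)).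
Proof.
move=> /order_nbhs_left[lA|[[[N i]|]]].
- exists 0; apply: lA; rewrite le_SomeSome Order.ProdLexiOrder.leEprodlexi /= !leEnat.
  by rewrite leqnSn ltnn.
- rewrite lt_SomeSome Order.ProdLexiOrder.ltEprodlexi /= !leEnat ltEnat /= ltn0 implybF.
  rewrite -ltnNge => /andP[_ Nm] lA; exists i.+1; apply: lA; last first.
    by rewrite le_SomeSome Order.ProdLexiOrder.leEprodlexi /= !leEnat leqnSn ltnn.
  rewrite lt_SomeSome Order.ProdLexiOrder.ltEprodlexi /= !leEnat ltEnat.
  by rewrite /= -ltnS Nm ltnS leqnn implybT.
- by rewrite lt_NoneSome.
Qed.

(** The last hypothesis is continuity of the inverse, phrased with neighborhoods in [X] rather than
    in the range type. *)
Lemma homeomorphism_to_range (Y X : topologicalType) (phi : Y -> X) :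
  injective phi -> continuous phi ->
  (forall y A, nbhs y A -> exists2 W, nbhs (phi y) W &
     forall y', W (phi y') -> A y') ->
  homeomorphism (to_range phi).
Proof.
move=> phiI phic phio; split.
  move=> y A [B [[W Wo <-] /= Wy WA]].
  have : nbhs (phi y) W by apply: open_nbhs_nbhs.
  move=> /phic; rewrite nbhs_simpl /=.
  by apply: filterS => y' Wy'; apply: WA.
have : forall z : range phi, exists y, phi y = val z.
  by move=> [z /= /set_mem [y _ yz]]; exists y.
move=> /choice[g gP]; exists g; split=> [y|z|z A].
- by apply: phiI; rewrite gP.
- by apply: val_inj; rewrite /= gP.
- move=> /phio[W Wz WA].
  have : nbhs z (val @^-1` W) by apply: initial_continuous; rewrite gP in Wz.
  by rewrite nbhs_simpl /=; apply: filterS => z' Wz'; apply: WA; rewrite gP.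
Qed.

Lemma homeomorphism_to_range_inj (Y X : topologicalType) (phi : Y -> X) :
  homeomorphism (to_range phi) -> continuous phi /\ injective phi.
Proof.
move=> [phic [g [phiK _ _]]]; split.
  have -> : phi = val \o to_range phi by [].
  move=> y; apply: continuous_comp; first exact: phic.
  exact: initial_continuous.
move=> y y' E; apply: (can_inj phiK); exact: val_inj.
Qed.

(** * The space *)

(** The value [f 0] also sets how late [d] must be. The successor in [(d + f d).+1] includes place
    [d] itself, so the guessed point leaves [x] at [d] too. *)
Definition guess_nbhd (s : binseq -> nat -> nat -> binseq) (x : binseq)
    (f : nat -> nat) : set binseq :=
  [set y | y = x \/ exists d l n, [/\ splits_at d x y, f 0 <= d, l <= d, n <= d
    & agree (d + f d).+1 y (s x l n)]].

Section GuessNbhd.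
Variable s : binseq -> nat -> nat -> binseq.

Lemma guess_nbhd_self x f : guess_nbhd s x f x.
Proof. by left. Qed.

Lemma guess_nbhd_le x f g : (forall n, f n <= g n) ->
  guess_nbhd s x g `<=` guess_nbhd s x f.
Proof.
move=> fg y [->|[d [l [n [xy gd ld nd ys]]]]]; first by left.
right; exists d, l, n; split=> //; first exact: leq_trans gd.
by apply: agree_le ys; rewrite ltnS leq_add2l.
Qed.

Lemma guess_nbhd_agree x f y : guess_nbhd s x f y -> agree (f 0) x y.
Proof. by move=> [->//|[d [l [n [[xy _] fd _ _ _]]]]]; apply: agree_le fd xy. Qed.

Lemma guess_nbhd_splits x f y d : splits_at d x y -> guess_nbhd s x f y ->
  f 0 <= d /\ exists l n, [/\ l <= d, n <= d & agree (d + f d).+1 y (s x l n)].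
Proof.
move=> dxy [yx|[d' [l [n [d'xy fd ld nd ys]]]]].
  by case: (splits_neq dxy).
by rewrite -(splits_uniq dxy d'xy) in fd ld nd ys; split=> //; exists l, n.
Qed.

(** For a point that leaves [x] at [d], membership is decided by its first [(d + f d).+1] values.
    This makes the neighborhoods clopen. *)
Lemma guess_nbhd_agree_closed x f y z d : splits_at d x y ->
  agree (d + f d).+1 y z -> guess_nbhd s x f y -> guess_nbhd s x f z.
Proof.
move=> dxy yz /(guess_nbhd_splits dxy)[fd [l [n [ld nd ys]]]].
right; exists d, l, n; split=> //.
  by apply: splits_agree dxy yz _; rewrite ltnS leq_addr.
exact: agree_trans (agree_sym yz) ys.
Qed.

(* If [q j] lies in the neighborhood of [x] given by [f], then [f] at the place
   where [q j] leaves [x] is bounded by the length of agreement of [q j] with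
   the nearby guessed points. *)
Lemma guess_nbhd_bounded x (q : nat -> binseq) (H : set (nat -> nat)) :
  (forall f, H f -> {homo f : m n / m <= n}) ->
  (forall j, exists d, [/\ j <= d, splits_at d x (q j) &
     forall l n, l <= d -> n <= d -> q j <> s x l n]) ->
  (forall f, H f -> exists J, forall j, J <= j -> guess_nbhd s x f (q j)) ->
  bounded_family H.
Proof.
move=> Hmono /choice[d dP] Hq.
have /choice[L LP] : forall j, exists L,
    forall l n, l <= d j -> n <= d j -> ~ agree L (q j) (s x l n).
  move=> j; have [L LP] := agree_separates (q j) (s x) (d j).
  by exists L => l n ld nd /(LP _ _ ld nd); case: (dP j) => _ _; apply.
exists L => f Hf; have [J JP] := Hq f Hf.
exists J => // j /= /JP; have [jd dxq _] := dP j.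
move=> /(guess_nbhd_splits dxq)[_ [l [n [ld nd qs]]]].
(* Monotonicity reduces the bound on [f j] to one on [f (d j)], as [j <= d j]. *)
apply: leq_trans (Hmono f Hf _ _ jd) _.
rewrite leqNgt; apply/negP => Lf; apply: (LP j l n ld nd).
apply: agree_le qs; apply: leqW; apply: leq_trans (ltnW Lf) (leq_addl _ _).
Qed.

End GuessNbhd.

Definition guess_space (F : set (nat -> nat)) (dF : directed_family F)
  (s : binseq -> nat -> nat -> binseq) : Type := binseq.

Section GuessSpace.
Variables (F : set (nat -> nat)) (dF : directed_family F).
Variable s : binseq -> nat -> nat -> binseq.
Local Notation X := (guess_space dF s).
Local Notation U := (guess_nbhd s).

Definition guess_open (A : set X) : Prop :=
  forall x : X, A x -> exists2 f, F f & U x f `<=` A.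

Let guess_openT : guess_open setT.
Proof. by move=> x _; have [_ /(_ 0)[f Ff _] _] := dF; exists f. Qed.

Let guess_openI : setI_closed guess_open.
Proof.
move=> A B Ao Bo x [/Ao[f Ff UA] /Bo[g Fg UB]].
have [_ _ /(_ f g Ff Fg)[h [Fh fh gh]]] := dF; exists h => // y Uy.
by split; [apply/UA/(guess_nbhd_le fh) | apply/UB/(guess_nbhd_le gh)].
Qed.

Let guess_open_bigcup (I : Type) (A : I -> set X) :
  (forall i, guess_open (A i)) -> guess_open (\bigcup_i A i).
Proof.
move=> Ao x [i _ /Ao[f Ff UA]]; exists f => // y /UA Ay.
by exists i.
Qed.

HB.instance Definition _ := Choice.copy X (nat -> bool).
HB.instance Definition _ :=
  isOpenTopological.Build X guess_openT guess_openI guess_open_bigcup.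

Lemma guess_openE (A : set X) : open A = guess_open A.
Proof. by []. Qed.

Lemma open_agree (x : X) k : open (agree k x : set X).
Proof.
rewrite guess_openE.
move=> y xy; have [_ /(_ k)[f Ff kf] _] := dF; exists f => // z /guess_nbhd_agree.
by move=> /(agree_le kf); apply: agree_trans.
Qed.

Lemma nbhs_agree (x : X) k : nbhs x (agree k x : set X).
Proof. by apply: open_nbhs_nbhs; split=> //; exact: open_agree. Qed.

Lemma clopen_guess_nbhd (x : X) f : F f -> clopen (U x f : set X).
Proof.
move=> Ff; split; first rewrite guess_openE => y Uy.
  have [->|/nesym/neq_splits[d dxy]] := pselect (y = x); first by exists f.
  have [_ /(_ (d + f d).+1)[g Fg gd] _] := dF; exists g => // z.
  move=> /guess_nbhd_agree/(agree_le gd) yz.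
  exact: guess_nbhd_agree_closed dxy yz Uy.
rewrite -openC guess_openE => y nUy.
have [d dxy] : exists d, splits_at d x y.
  by apply: neq_splits => xy; apply: nUy; rewrite /= xy; left.
have [_ /(_ (d + f d).+1)[g Fg gd] _] := dF; exists g => // z.
move=> /guess_nbhd_agree/(agree_le gd) yz Uz; apply: nUy.
apply: guess_nbhd_agree_closed (agree_sym yz) Uz.
by apply: splits_agree dxy yz _; rewrite ltnS leq_addr.
Qed.

Lemma nbhs_guess_nbhd (x : X) f : F f -> nbhs x (U x f : set X).
Proof.
move=> Ff; apply: open_nbhs_nbhs; split; last exact: guess_nbhd_self.
by case: (clopen_guess_nbhd x Ff).
Qed.

Lemma nbhs_guessP (x : X) (A : set X) : nbhs x A -> exists2 f, F f & U x f `<=` A.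
Proof.
rewrite nbhsE => -[B [Bo Bx] BA]; rewrite guess_openE in Bo.
have [f Ff UB] := Bo x Bx.
by exists f => // y /UB/BA.
Qed.

Lemma guess_space_clopen_base : has_clopen_base X.
Proof.
exists clopen => //; split=> [A []//|x A /nbhs_guessP[f Ff UA]].
exists (U x f) => //; split; first exact: clopen_guess_nbhd.
exact: guess_nbhd_self.
Qed.

Lemma guess_space_regular : regular_space X.
Proof.
move=> x A /nbhs_guessP[f Ff UA]; exists (U x f); first exact: nbhs_guess_nbhd.
have [_ /closure_id <-] := clopen_guess_nbhd x Ff.
exact: UA.
Qed.

Lemma guess_space_accessible : accessible_space X.
Proof.
move=> x y /eqP /neq_splits[d [_ xy]]; exists (agree d.+1 x); split.
- exact: open_agree.
- by rewrite inE.
- by rewrite inE => /(_ d (leqnn _)).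
Qed.

(** * Local bases and the character of the space *)

Definition guess_base (x : X) : set (set X) := [set U x f | f in F].

Lemma guess_base_local (x : X) : local_base x (guess_base x).
Proof.
split=> [_ [f Ff <-]|A /nbhs_guessP[f Ff UA]].
  by split; [case: (clopen_guess_nbhd x Ff) | left].
by exists (U x f) => //; exists f.
Qed.

(** Each [B] in [N] contains [U x (h B)] for some [h B] in [F]. If some [g] bounded all [h B],
    points following guessed ones up to [d + g d] without being guessed would converge to [x] and
    bound [F]. So the image of [h] is unbounded. *)
Lemma guess_local_base_card_ge (x : X) (N : set (set X)) :
  least_size [set G | ~ bounded_family G] F ->
  (forall j, exists d l n, [/\ j <= d, l <= d, n <= d & splits_at d x (s x l n)]) ->
  local_base x N -> F #<= N.
Proof.
move=> [Fu Fmin] sx [No Nx].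
have : forall B, exists f, N B -> F f /\ U x f `<=` B.
  move=> B; have [/No/open_nbhs_nbhs/nbhs_guessP[f Ff UB]|nNB] := pselect (N B).
    by exists f.
  by exists id.
move=> /choice[h hP].
apply: card_le_trans (card_image_le h N); apply: Fmin => -[g hg]; apply: Fu.
have : forall j, exists q : binseq, exists d l n, [/\ j <= d, l <= d, n <= d,
    splits_at d x q & agree (d + g d).+1 q (s x l n) /\ forall l n, q <> s x l n].
  move=> j; have [d [l [n [jd ld nd dxs]]]] := sx j.
  (* All guessed points of [x] are listed, and the diagonal places start only past [d + g d]. *)
  pose p i := if unpickle i is Some (l, n) then s x l n else x.
  have [|q [qs qp]] := @avoid_sequence p (s x l n) (addn (d + g d).+1).
    exact: addnI.
  have sq : agree (d + g d).+1 (s x l n) q.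
    by move=> i id; rewrite qs // => i' E; move: id; rewrite -E ltnNge leq_addr.
  exists q, d, l, n; split=> //.
    by apply: splits_agree dxs sq _; rewrite ltnS leq_addr.
  split; first exact: agree_sym.
  by move=> l' n' E; apply: (qp (pickle (l', n'))); rewrite /p pickleK.
move=> /choice[q qP].
apply: (@guess_nbhd_bounded s x q).
- by case: dF.
- by move=> j; have [d [l [n [jd _ _ dxq [_ qs]]]]] := qP j; exists d.
move=> f Ff; have [B NB BU] := Nx _ (nbhs_guess_nbhd x Ff).
have [FhB UB] := hP B NB.
have [M _ Mg] := hg (h B) (imageP h NB).
(* From [M] on, [g] dominates [h B]; [h B 0] makes the splitting place late enough. *)
exists (maxn M (h B 0)) => j; rewrite geq_max => /andP[Mj hj].
have [d [l [n [jd ld nd dxq [qs _]]]]] := qP j.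
apply/BU/UB; right; exists d, l, n; split=> //; first exact: leq_trans jd.
by apply: agree_le qs; rewrite ltnS leq_add2l; apply: Mg; apply: leq_trans jd.
Qed.

(** Every point has a base of size at most that of [F], and at [x] no base is smaller, so the
    supremum is attained there. *)
Lemma guess_space_character (x : X) :
  least_size [set G | ~ bounded_family G] F ->
  (forall j, exists d l n, [/\ j <= d, l <= d, n <= d & splits_at d x (s x l n)]) ->
  has_character X F.
Proof.
move=> Fb sx; have ge := guess_local_base_card_ge Fb sx.
have baseF y : guess_base y #<= F by exact: card_image_le.
have Fbase := ge _ (guess_base_local x).
exists (guess_base x); split.
- split=> [N [y [_ Nmin]]|L Lub].
    apply: card_le_trans Fbase; apply: card_le_trans (baseF y).
    exact/Nmin/guess_base_local.
  apply: Lub; exists x; split; first exact: guess_base_local.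
  by move=> N /ge; apply: card_le_trans.
- by move=> /(card_le_finite Fbase)/finite_bounded_family; case: Fb.
- by move=> _; rewrite card_eq_le Fbase baseF.
Qed.

(** * The two partition relations *)

Lemma guess_space_omega1 :
  (forall c : binseq -> nat, exists x, forall l,
    [/\ s x l (c x) <> x, agree l x (s x l (c x)) & c (s x l (c x)) = c x]) ->
  arrow_top X omega1 nat.
Proof.
move=> sguess c; have [x xP] := sguess c.
pose t l := s x l (c x).
have : forall l, exists d, l <= d /\ splits_at d x (t l).
  move=> l; have [/nesym/neq_splits[d dxt] xt _] := xP l.
  by exists d; split=> //; apply: agree_splits_le xt dxt.
move=> /choice[d dP].
(* Starting at [c x] ensures the condition [n <= d] for [n = c x]; the successor makes the splitting
   places [e k] strictly increasing. *)
pose r := fix r k := if k is k'.+1 then (d (r k')).+1 else c x.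
pose e k := d (r k).
have eS k : e k < e k.+1 by rewrite /e /=; case: (dP (d (r k)).+1).
have e_homo : {homo e : m n / m < n} by apply: (homo_ltn ltn_trans).
have e_mono : {mono e : m n / m <= n} by apply: leq_mono.
have ge_id k : k <= e k.
  by elim: k => // k IH; apply: leq_ltn_trans IH (eS k).
have cr k : c x <= r k.
  elim: k => //= k IH; apply: leqW; apply: leq_trans IH _; by case: (dP (r k)).
pose phi (p : omega1) : X := if p is Some k then t (r k) else x.
have phiS k : splits_at (e k) x (phi (Some k)) by case: (dP (r k)).
exists phi; split; last first.
  have cphi p : c (phi p) = c x by case: p => //= k; case: (xP (r k)).
  by move=> _ _ [p _ <-] [p' _ <-]; rewrite !cphi.
have e_inj : injective e by apply: incn_inj.
apply: homeomorphism_to_range.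
- move=> [k|] [k'|] // E.
  + congr Some; apply: e_inj; apply: splits_uniq (phiS k) _.
    by rewrite E.
  + by case: (splits_neq (phiS k)).
  + by case: (splits_neq (phiS k')).
- move=> [k|] A /=.
    move=> /nbhs_singleton At; rewrite nbhs_simpl /=.
    by apply: filterS (nbhs_omega1_Some k) => _ ->.
  move=> /nbhs_guessP[f Ff UA]; rewrite nbhs_simpl /=.
  apply: filterS (nbhs_omega1_None (f 0)) => -[k|] /= fk; apply: UA; last by left.
  have [re _] := dP (r k).
  right; exists (e k), (r k), (c x); split=> //.
  + exact: leq_trans (ltnW fk) (ge_id k).
  + exact: leq_trans (cr k) re.
- move=> [k|] A.
    (* A point of the image in this cylinder also leaves [x] at [e k], and these places are
       distinct. *)
    move=> /nbhs_singleton Ak; exists (agree (e k).+1 (phi (Some k))).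
      exact: nbhs_agree.
    have [xk xkd] := phiS k.
    move=> [k'|] pk'; last by case: xkd; rewrite pk'.
    have E : splits_at (e k) x (phi (Some k')) by apply: splits_agree (phiS k) pk' _.
    by rewrite (e_inj k' k) //; apply: splits_uniq (phiS k') E.
  move=> nA; have [N NA] := nbhs_omega1_NoneE nA.
  exists (agree (e N) x); first exact: nbhs_agree.
  move=> [k|] xk; last exact: nbhs_singleton nA.
  by apply: NA; rewrite -e_mono; apply: agree_splits_le xk (phiS k).
Qed.

(** The limit [z] of a copy of omega leaves [x] at some [d]. A point [q] of the copy close enough to
    [z] also leaves [x] at [d]; were it one of the finitely many guessed points with indices up to
    [d], it would equal [z]. Such points [q] from later and later copies converge to [x]. *)
Lemma guess_space_not_omega_sq1 : ~ bounded_family F ->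
  ~ arrow_top X omega_sq1 'I_1.
Proof.
move=> Fu /(_ (fun=> ord0))[phi [/homeomorphism_to_range_inj[phic phiI] _]].
pose x := phi None.
have : forall j, exists q : binseq, (exists m k, j <= m /\ q = phi (Some (m, k))) /\
    exists d, [/\ j <= d, splits_at d x q & forall l n, l <= d -> n <= d -> q <> s x l n].
  move=> j; have [m mP] := nbhs_omega_sq1_None (phic None _ (nbhs_agree x j)).
  pose m' := maxn m j; pose z := phi (Some (m'.+1, 0)).
  have [d dxz] : exists d, splits_at d x z by apply: neq_splits => /phiI.
  have [L LP] := agree_separates z (s x) d.
  have [k zq] := nbhs_omega_sq1_limit (phic _ _ (nbhs_agree z (maxn L d.+1))).
  have dxq : splits_at d x (phi (Some (m', k))).
    by apply: splits_agree dxz zq _; rewrite leq_max leqnn orbT.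
  exists (phi (Some (m', k))); split; first by exists m', k; rewrite leq_max leqnn orbT.
  exists d; split=> //.
    by apply: agree_splits_le dxq; apply: mP; rewrite leq_maxl.
  move=> l n ld nd E.
  have /phiI[/esym/n_Sn//] : z = phi (Some (m', k)).
  rewrite E; apply: LP => //; rewrite -E.
  by apply: agree_le zq; rewrite leq_maxl.
move=> /choice[q qP]; apply: Fu; apply: (@guess_nbhd_bounded s x q).
- by case: dF.
- by move=> j; case: (qP j).
(* Continuity at the top puts all copies from [m] on into the neighborhood, and [q j] lies in a copy
   of index at least [j]. *)
move=> f Ff; have [m mP] := nbhs_omega_sq1_None (phic None _ (nbhs_guess_nbhd x Ff)).
exists m => j mj; have [[m' [k [jm' ->]]] _] := qP j.
by apply: mP; apply: leq_trans jm'.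
Qed.

End GuessSpace.

Theorem theorem1 :
  exists X : topologicalType,
    [/\ has_clopen_base X, regular_space X & accessible_space X] /\
    [set: X] #= [set: nat -> bool] /\
    (exists F : set (nat -> nat),
       least_size [set G | ~ bounded_family G] F /\ has_character X F) /\
    arrow_top X omega1 nat /\
    ~ arrow_top X omega_sq1 'I_1.
Proof.
have [F [dF Fb]] := exists_directed_least_unbounded.
have [s sguess] := exists_guessing.
exists (guess_space dF s); split.
  split.
  - exact: guess_space_clopen_base.
  - exact: guess_space_regular.
  - exact: guess_space_accessible.
split; first exact: card_eqxx.
split; last first.
  by split; [exact: guess_space_omega1 | apply: guess_space_not_omega_sq1; case: Fb].
exists F; split=> //.
(* A constant coloring already yields a point that is a limit of its guessed points [s x j 0]. *)
have [x xP] := sguess (fun=> 0).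
apply: (@guess_space_character _ _ _ x) => // j.
have [/nesym/neq_splits[d dxs] xs _] := xP j.
have jd := agree_splits_le xs dxs.
by exists d, j, 0.
Qed.
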